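(* Let $\mathcal C\subset\mathbb R^n$ be nonempty, compact and convex; let $f:\mathbb R^n\to\mathbb R$ be continuously differentiable on an open set containing $\mathcal C$ with $\nabla f$ Lipschitz-continuous on $\mathcal C$; let $T:\mathbb R^n\to\mathbb R^m$ be linear; and let $g:\mathbb R^m\to\mathbb R$ be $L_g$-Lipschitz on $\mathbb R^m$ and $\rho$-weakly convex for some $\rho\ge0$. Assume the proximal lift property: there is $M_{\mathrm{lift}}>0$ such that for every $x\in\mathcal C$ and every $\beta\in\,]0,\rho^{-1}[$ there exists $z=z(x,\beta)\in\mathcal C$ with $Tz=\mathrm{prox}_{\beta g}(Tx)$ and $\|z-x\|_2\le M_{\mathrm{lift}}\|Tz-Tx\|_2$. Let $(x_k)_{k\in\mathbb N}$ be generated by FRAMES with $\gamma_k=(k+1)^{-1/2}$ and $\beta_k=\beta_0(k+1)^{-1/4}$, where $\beta_0\in\,]0,\rho^{-1}[$. For each $k$ let $z_k:=z(x_k,\beta_k)$ be chosen as in the proximal lift property and set $\xi_k:=\nabla g^{\beta_k}(Tx_k)$. Then there exists a constant $C_{\mathrm{ns}}>0$ such that for every integer $N\ge1$, $$0\le\frac1N\sum_{k=0}^{N-1}\mathrm{gap}(z_k;\xi_k)\le C_{\mathrm{ns}}N^{-1/4},$$ and consequently $$0\le\min_{0\le k\le N-1}\mathrm{gap}(z_k;\xi_k)\le C_{\mathrm{ns}}N^{-1/4}.$$ Moreover, for $N\ge2$ and $k_N^*\in\operatorname{argmin}_{\lfloor N/2\rfloor\le k\le N-1}\mathrm{gap}^{\beta_k}(x_k)$,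 one has $\mathrm{gap}(z_{k_N^*};\xi_{k_N^*})=\mathcal O(N^{-1/4})$.
   Context: Conventions: $\rho^{-1}=+\infty$ if $\rho=0$. $\rho$-weakly convex means $g+\frac{\rho}{2}\|\cdot\|_2^2$ is convex. $\partial g$ is the Clarke subdifferential. For $\beta\in\,]0,\rho^{-1}[$: $\mathrm{prox}_{\beta g}(y)=\operatorname{argmin}_u\{g(u)+\frac1{2\beta}\|u-y\|_2^2\}$ (unique), and the Moreau envelope $g^\beta(y)=\min_u\{g(u)+\frac1{2\beta}\|u-y\|_2^2\}$ is continuously differentiable with $\nabla g^\beta(y)=\beta^{-1}(y-\mathrm{prox}_{\beta g}(y))$. Smoothed Frank-Wolfe gap: for $x\in\mathcal C$, $\mathrm{gap}^\beta(x):=\max_{s\in\mathcal C}\langle\nabla f(x)+T^*\nabla g^\beta(Tx),x-s\rangle$. Nonsmooth Frank-Wolfe subgradient gap: for $\xi\in\partial g(Tx)$, $\mathrm{gap}(x;\xi):=\max_{s\in\mathcal C}\langle\nabla f(x)+T^*\xi,x-s\rangle$. (Here $\xi_k\in\partial g(Tz_k)$, by the optimality condition of the prox.) FRAMES: given $x_0\in\mathcal C$, step sizes $\gamma_k\in\,]0,1]$ and smoothing parameters $\beta_k\in\,]0,\rho^{-1}[$, for $k=0,1,2,\dots$ let $\Phi_k(x)=f(x)+g^{\beta_k}(Tx)$, choose any $s_k\in\operatorname{argmin}_{s\in\mathcal C}\langle\nabla\Phi_k(x_k),s\rangle$, and set $x_{k+1}=x_k+\gamma_k(s_k-x_k)$.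 $\mathcal O(N^{-1/4})$ means bounded by a constant independent of $N$ times $N^{-1/4}$; $C_{\mathrm{ns}}$ is independent of $N$. *)

(* Defs.v *)
From HB Require Import structures.
From mathcomp Require Import all_boot all_order all_algebra.
From mathcomp Require Import all_classical all_reals all_analysis.

Set Implicit Arguments.
Unset Strict Implicit.
Unset Printing Implicit Defensive.

Import Order.TTheory GRing.Theory Num.Theory.
Import numFieldNormedType.Exports.

Local Open Scope classical_set_scope.
Local Open Scope ring_scope.

(* R^n is 'rV[R]_n. The library norm `|u| on matrices is the sup norm, so the
   Euclidean inner product and norm are introduced separately; the topology
   (compactness, differentiability, limits) is the same for both norms. *)
Definition dot (R : realType) (n : nat) (u v : 'rV[R]_n) : R :=
  \sum_(i < n) u 0 i * v 0 i.

Definition enorm (R : realType) (n : nat) (u : 'rV[R]_n) : R :=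
  Num.sqrt (dot u u).

(* Only meaningful at points where h is differentiable. *)
Definition grad (R : realType) (n : nat) (h : 'rV[R]_n -> R) (x : 'rV[R]_n)
    : 'rV[R]_n :=
  \row_(i < n) 'D_(delta_mx 0 i) (h : 'rV[R]_n -> R^o) x.

Definition adjoint (R : realType) (n m : nat)
    (T : {linear 'rV[R]_n -> 'rV[R]_m}) (v : 'rV[R]_m) : 'rV[R]_n :=
  v *m (lin1_mx T)^T.

Lemma adjointP (R : realType) (n m : nat)
    (T : {linear 'rV[R]_n -> 'rV[R]_m}) (u : 'rV[R]_n) (v : 'rV[R]_m) :
  dot (T u) v = dot u (adjoint T v).
Proof.
have dotE p (a b : 'rV[R]_p) : dot a b = (a *m b^T) 0 0.
  by rewrite /dot mxE; apply: eq_bigr => i _; rewrite mxE.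
by rewrite !dotE /adjoint trmx_mul trmxK mulmxA mul_rV_lin1.
Qed.

Definition argmin (I : Type) (R : realType) (D : set I) (F : I -> R) : set I :=
  [set i | D i /\ forall j, D j -> F i <= F j].

Definition weakly_convex (R : realType) (m : nat) (rho : R)
    (g : 'rV[R]_m -> R) : Prop :=
  @convex_function R 'rV[R]_m setT (fun u => g u + rho / 2 * enorm u ^+ 2).

(* beta lies in ]0, rho^-1[; the inverse is the one of \bar R, for which
   0^-1 = +oo (in R one would get 0^-1 = 0). *)
Definition smoothing_range (R : realType) (rho beta : R) : Prop :=
  0 < beta /\ (beta%:E < (rho%:E)^-1)%E.

Definition prox_objective (R : realType) (m : nat) (beta : R)
    (g : 'rV[R]_m -> R) (y u : 'rV[R]_m) : R :=
  g u + (2 * beta)^-1 * enorm (u - y) ^+ 2.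

(* For g weakly convex and beta in the smoothing range the argmin is a
   singleton and the infimum below is attained. *)
Definition prox (R : realType) (m : nat) (beta : R) (g : 'rV[R]_m -> R)
    (y : 'rV[R]_m) : 'rV[R]_m :=
  xget 0 (argmin setT (prox_objective beta g y)).

Definition moreau (R : realType) (m : nat) (beta : R) (g : 'rV[R]_m -> R)
    (y : 'rV[R]_m) : R :=
  inf (range (prox_objective beta g y)).

Definition clarke_derivative (R : realType) (m : nat) (g : 'rV[R]_m -> R)
    (y v : 'rV[R]_m) : \bar R :=
  limf_esup
    (fun p : 'rV[R]_m * R => ((g (p.1 + p.2 *: v) - g p.1) / p.2)%:E)
    (filter_prod (nbhs y) (0 : R)^'+).

Definition clarke_subdifferential (R : realType) (m : nat)
    (g : 'rV[R]_m -> R) (y : 'rV[R]_m) : set 'rV[R]_m :=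
  [set xi | forall v, ((dot xi v)%:E <= clarke_derivative g y v)%E].

(* The suprema in the two gaps are maxima, since C is compact. *)
Definition smoothed_gap (R : realType) (n m : nat) (C : set 'rV[R]_n)
    (f : 'rV[R]_n -> R) (T : {linear 'rV[R]_n -> 'rV[R]_m})
    (g : 'rV[R]_m -> R) (beta : R) (x : 'rV[R]_n) : R :=
  sup [set dot (grad f x + adjoint T (grad (moreau beta g) (T x))) (x - s)
      | s in C].

(* Intended for xi in the Clarke subdifferential of g at T x. *)
Definition subgradient_gap (R : realType) (n m : nat) (C : set 'rV[R]_n)
    (f : 'rV[R]_n -> R) (T : {linear 'rV[R]_n -> 'rV[R]_m})
    (x : 'rV[R]_n) (xi : 'rV[R]_m) : R :=
  sup [set dot (grad f x + adjoint T xi) (x - s) | s in C].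

Definition prox_lift (R : realType) (n m : nat) (C : set 'rV[R]_n)
    (T : {linear 'rV[R]_n -> 'rV[R]_m}) (g : 'rV[R]_m -> R) (M : R)
    (x : 'rV[R]_n) (beta : R) (z : 'rV[R]_n) : Prop :=
  [/\ C z, T z = prox beta g (T x) & enorm (z - x) <= M * enorm (T z - T x)].

Definition frames (R : realType) (n m : nat) (C : set 'rV[R]_n)
    (f : 'rV[R]_n -> R) (T : {linear 'rV[R]_n -> 'rV[R]_m})
    (g : 'rV[R]_m -> R) (rho : R) (gamma beta : nat -> R)
    (x s : nat -> 'rV[R]_n) : Prop :=
  let Phi k y := f y + moreau (beta k) g (T y) in
  [/\ C (x 0%N),
      forall k, 0 < gamma k <= 1,
      forall k, smoothing_range rho (beta k),
      forall k, argmin C (fun v => dot (grad (Phi k) (x k)) v) (s k)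
    & forall k, x k.+1 = x k + gamma k *: (s k - x k)].

(* Main.v *)
Require Import Defs.
From HB Require Import structures.
From mathcomp Require Import all_boot all_order all_algebra.
From mathcomp Require Import all_classical all_reals all_analysis.
From mathcomp Require Import ring lra zify.

Set Implicit Arguments.
Unset Strict Implicit.
Unset Printing Implicit Defensive.

Import Order.TTheory GRing.Theory Num.Theory.
Import numFieldNormedType.Exports.

Local Open Scope classical_set_scope.
Local Open Scope ring_scope.

(* The descent inequality with step x + gamma (s - x) only needs the upper bound
   g^b(y + d) <= g^b(y) + <grad g^b(y), d> + |d|^2 / (2 b), which holds without
   convexity; weak convexity enters only in making the prox Lipschitz, hence g^b
   differentiable.  Lowering b to b' <= b <= 2 b' raises g^b by O(b - b'), which
   telescopes, so Psi_k = Phi_k(x_k) + 4 L^2 beta_k is bounded and satisfies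
   gamma_k gap_k <= Psi_k - Psi_(k+1) + O(gamma_k^2 / beta_k).  Dividing by
   gamma_k and summing by parts gives sum_(k < N) gap_k = O(N^(3/4)).  Passing
   from x_k to z_k costs only O(beta_k) = O(k^(-1/4)) because
   |T z_k - T x_k| <= 2 beta_k L; and the smallest smoothed gap over the last
   half is at most 2/N times the full sum. *)

(** * Euclidean norm *)

Lemma dotC (R : realType) n (u v : 'rV[R]_n) : dot u v = dot v u.
Proof. by apply: eq_bigr => i _; rewrite mulrC. Qed.

Lemma dotDl (R : realType) n (u v w : 'rV[R]_n) :
  dot (u + v) w = dot u w + dot v w.
Proof. by rewrite /dot -big_split; apply: eq_bigr => i _; rewrite mxE mulrDl. Qed.

Lemma dotZl (R : realType) n a (u v : 'rV[R]_n) : dot (a *: u) v = a * dot u v.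
Proof. by rewrite /dot mulr_sumr; apply: eq_bigr => i _; rewrite mxE mulrA. Qed.

Lemma dotNl (R : realType) n (u v : 'rV[R]_n) : dot (- u) v = - dot u v.
Proof. by rewrite -scaleN1r dotZl mulN1r. Qed.

Lemma dotDr (R : realType) n (u v w : 'rV[R]_n) :
  dot u (v + w) = dot u v + dot u w.
Proof. by rewrite dotC dotDl !(dotC _ u). Qed.

Lemma dotZr (R : realType) n a (u v : 'rV[R]_n) : dot u (a *: v) = a * dot u v.
Proof. by rewrite dotC dotZl dotC. Qed.

Lemma dotNr (R : realType) n (u v : 'rV[R]_n) : dot u (- v) = - dot u v.
Proof. by rewrite dotC dotNl dotC. Qed.

Definition dotE := (dotDl, dotDr, dotNl, dotNr, dotZl, dotZr).

Lemma dot_ge0 (R : realType) n (u : 'rV[R]_n) : 0 <= dot u u.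
Proof. by apply: sumr_ge0 => i _; rewrite -expr2 sqr_ge0. Qed.

Lemma enorm_ge0 (R : realType) n (u : 'rV[R]_n) : 0 <= enorm u.
Proof. exact: sqrtr_ge0. Qed.

Lemma enorm_sqr (R : realType) n (u : 'rV[R]_n) : enorm u ^+ 2 = dot u u.
Proof. by rewrite sqr_sqrtr // dot_ge0. Qed.

Lemma enormZ (R : realType) n a (u : 'rV[R]_n) : enorm (a *: u) = `|a| * enorm u.
Proof.
by rewrite /enorm dotZl dotZr mulrA -expr2 sqrtrM ?sqr_ge0// sqrtr_sqr.
Qed.

Lemma enormN (R : realType) n (u : 'rV[R]_n) : enorm (- u) = enorm u.
Proof. by rewrite -scaleN1r enormZ normrN1 mul1r. Qed.

Lemma enormB (R : realType) n (u v : 'rV[R]_n) : enorm (u - v) = enorm (v - u).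
Proof. by rewrite -enormN opprB. Qed.

Lemma coord_le_enorm (R : realType) n (u : 'rV[R]_n) i : `|u 0 i| <= enorm u.
Proof.
rewrite -ler_sqr ?nnegrE ?enorm_ge0// enorm_sqr real_normK ?num_real//.
rewrite /dot (bigD1 i)//= -expr2 lerDl.
by apply: sumr_ge0 => j _; rewrite -expr2 sqr_ge0.
Qed.

Lemma norm_le_enorm (R : realType) n (u : 'rV[R]_n) : `|u| <= enorm u.
Proof.
rewrite [leLHS]/Num.norm /= mx_normrE; apply/bigmax_leP; split.
  exact: enorm_ge0.
by move=> [i j] _ /=; rewrite (ord1 i); exact: coord_le_enorm.
Qed.

Lemma enorm0_eq0 (R : realType) n (u : 'rV[R]_n) : enorm u = 0 -> u = 0.
Proof.
by move=> u0; apply/eqP; rewrite -normr_le0 -u0 norm_le_enorm.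
Qed.

(** Expanding the square of [enorm v *: u - enorm u *: v] and dividing by [enorm u * enorm v] gives
    the bound. Replacing [u] by [- u] fixes the sign, and zero vectors are treated apart. *)
Lemma cauchy_schwarz (R : realType) n (u v : 'rV[R]_n) :
  `|dot u v| <= enorm u * enorm v.
Proof.
wlog uv0 : u / 0 <= dot u v => [W|].
  have [/W//|/ltW uv0] := leP 0 (dot u v).
  by rewrite -(enormN u) -normrN -dotNl W// dotNl oppr_ge0.
rewrite ger0_norm//.
have dot0 (w : 'rV[R]_n) : dot 0 w = 0 by rewrite -(scale0r w) dotZl mul0r.
have [/enorm0_eq0->|u0] := eqVneq (enorm u) 0.
  by rewrite dot0 mulr_ge0 ?enorm_ge0.
have [/enorm0_eq0->|v0] := eqVneq (enorm v) 0.
  by rewrite dotC dot0 mulr_ge0 ?enorm_ge0.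
have up : 0 < enorm u by rewrite lt_neqAle eq_sym u0 enorm_ge0.
have vp : 0 < enorm v by rewrite lt_neqAle eq_sym v0 enorm_ge0.
have := dot_ge0 (enorm v *: u - enorm u *: v).
rewrite !dotE (dotC v u) -!enorm_sqr => H.
have uvp := mulr_gt0 up vp.
rewrite -subr_ge0 -(pmulr_rge0 _ uvp); lra.
Qed.

Lemma dot_le_enorm (R : realType) n (u v : 'rV[R]_n) :
  dot u v <= enorm u * enorm v.
Proof. exact: le_trans (ler_norm _) (cauchy_schwarz u v). Qed.

Lemma enormD (R : realType) n (u v : 'rV[R]_n) :
  enorm (u + v) <= enorm u + enorm v.
Proof.
rewrite -ler_sqr ?nnegrE ?addr_ge0 ?enorm_ge0// enorm_sqr !dotE (dotC v u).
have := dot_le_enorm u v; rewrite sqrrD !enorm_sqr; lra.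
Qed.

Lemma enorm0 (R : realType) n : enorm (0 : 'rV[R]_n) = 0.
Proof. by rewrite -(scale0r (0 : 'rV[R]_n)) enormZ normr0 mul0r. Qed.

Lemma enorm_sum (R : realType) n (I : Type) (r : seq I) (F : I -> 'rV[R]_n) :
  enorm (\sum_(i <- r) F i) <= \sum_(i <- r) enorm (F i).
Proof.
elim/big_ind2 : _ => [|u a v b ua vb|//]; first by rewrite enorm0.
exact: le_trans (enormD _ _) (lerD ua vb).
Qed.

(** Expansion in the standard basis. It serves twice: for the operator norm of [T], and with the
    identity for comparing the Euclidean and sup norms. *)
Lemma linear_enorm_coord (R : realType) n m (T : {linear 'rV[R]_n -> 'rV[R]_m})
    (u : 'rV[R]_n) :
  enorm (T u) <= \sum_j `|u 0 j| * enorm (T (delta_mx 0 j)).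
Proof.
rewrite {1}(row_sum_delta u) linear_sum.
apply: le_trans (enorm_sum _ _) _; apply: ler_sum => j _.
by rewrite linearZ enormZ.
Qed.

Lemma linear_enorm_bounded (R : realType) n m
    (T : {linear 'rV[R]_n -> 'rV[R]_m}) :
  exists2 K, 0 <= K & forall u, enorm (T u) <= K * enorm u.
Proof.
exists (\sum_j enorm (T (delta_mx 0 j))).
  by apply: sumr_ge0 => j _; exact: enorm_ge0.
move=> u; apply: le_trans (linear_enorm_coord _ _) _.
rewrite mulr_suml; apply: ler_sum => j _.
by rewrite mulrC ler_wpM2l ?enorm_ge0 ?coord_le_enorm.
Qed.

Lemma enorm_le_norm (R : realType) n :
  exists2 K, 0 <= K & forall u : 'rV[R]_n, enorm u <= K * `|u|.
Proof.
exists (\sum_j enorm (delta_mx 0 j : 'rV[R]_n)).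
  by apply: sumr_ge0 => j _; exact: enorm_ge0.
move=> u; apply: le_trans (linear_enorm_coord idfun _) _.
rewrite mulr_suml; apply: ler_sum => j _.
rewrite mulrC ler_wpM2l ?enorm_ge0// [leRHS]/Num.norm /= mx_normrE.
by apply/bigmax_geP; right; exists (0, j).
Qed.

Lemma compact_enorm_diameter (R : realType) n (C : set 'rV[R]_n) :
  compact C -> exists2 D, 0 <= D & forall u v, C u -> C v -> enorm (u - v) <= D.
Proof.
move=> /compact_bounded [M [_ CM]]; have [K K0 hK] := enorm_le_norm R n.
exists (K * (`|M| + 1) + K * (`|M| + 1)).
  by rewrite addr_ge0// mulr_ge0// addr_ge0.
have CK u : C u -> enorm u <= K * (`|M| + 1).
  move=> Cu; apply: le_trans (hK u) _; apply: ler_wpM2l => //.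
  by apply: CM Cu; rewrite (le_lt_trans (ler_norm M))// ltrDl.
by move=> u v Cu Cv; rewrite (le_trans (enormD _ _))// enormN lerD ?CK.
Qed.

(** * Proximal map and Moreau envelope *)

Lemma lipschitz_enorm_continuous (R : realType) m (g : 'rV[R]_m -> R) (L : R) :
  0 <= L -> (forall u v, `|g u - g v| <= L * enorm (u - v)) ->
  continuous (g : 'rV[R]_m -> R^o).
Proof.
move=> L0 gL u; have [K K0 hK] := enorm_le_norm R m.
have LK : 0 < L * K + 1 by rewrite ltr_wpDl ?mulr_ge0.
apply/(@cvgrPdist_le _ _ _ (nbhs u) _ g (g u)) => e e0.
have /(_ _ (divr_gt0 e0 LK)) :=
  @cvgr_dist_le _ _ _ (nbhs u) (nbhs_filter u) id u (@cvg_id _ (nbhs u)).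
apply: (@filterS _ (nbhs u)) => v uv.
apply: le_trans (gL _ _) _; apply: le_trans (ler_wpM2l L0 (hK _)) _.
rewrite mulrA; apply: (@le_trans _ _ ((L * K + 1) * `|u - v|)).
  by rewrite ler_wpM2r// lerDl.
by rewrite -ler_pdivlMl// mulrC.
Qed.

Lemma prox_objective_continuous (R : realType) m (b : R) (g : 'rV[R]_m -> R)
    (L : R) y :
  0 <= L -> (forall u v, `|g u - g v| <= L * enorm (u - v)) ->
  continuous (prox_objective b g y : 'rV[R]_m -> R^o).
Proof.
move=> L0 gL u; apply: (@cvgD _ _ _ (nbhs u)).
  exact: (lipschitz_enorm_continuous L0 gL).
apply: (@cvgM _ _ (nbhs u)); first exact: cvg_cst.
rewrite (_ : (fun v => _) = fun v => dot (v - y) (v - y)); last first.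
  by apply/funext => v; rewrite enorm_sqr.
rewrite enorm_sqr; apply: (@cvg_big R^o _ _ _ _ _ _ (nbhs u)) => [|i _].
  exact: add_continuous.
have cB : (v - y) 0 i @[v --> nbhs u] --> (u - y) 0 i.
  rewrite (_ : (fun v : 'rV[R]_m => _) = fun v : 'rV[R]_m => v 0 i - y 0 i).
  2: by apply/funext => v; rewrite !mxE.
  rewrite !mxE.
  by apply: (@cvgB _ _ _ (nbhs u)); [exact: coord_continuous|exact: cvg_cst].
exact: (@cvgM _ _ (nbhs u)).
Qed.

Lemma prox_objective_at (R : realType) m (b : R) (g : 'rV[R]_m -> R) y :
  prox_objective b g y y = g y.
Proof. by rewrite /prox_objective subrr enorm0 expr0n mulr0 addr0. Qed.

(** On the sublevel set the quadratic penalty is at most [g y - g u <= L * enorm (u - y)]; dividing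
    by the distance gives the radius. *)
Lemma sublevel_dist (R : realType) m (b : R) (g : 'rV[R]_m -> R) (L : R) y u :
  0 < b -> 0 <= L -> (forall u v, `|g u - g v| <= L * enorm (u - v)) ->
  prox_objective b g y u <= g y -> enorm (u - y) <= 2 * b * L.
Proof.
move=> b0 L0 gL; rewrite /prox_objective => H.
have := gL y u; rewrite ler_norml => /andP[_]; rewrite enormB => gyu.
have [->|d0] := eqVneq (enorm (u - y)) 0; first by rewrite !mulr_ge0// ltW.
have dp : 0 < enorm (u - y) by rewrite lt_neqAle eq_sym d0 enorm_ge0.
have {H}: (2 * b)^-1 * enorm (u - y) ^+ 2 <= L * enorm (u - y) by lra.
rewrite expr2 mulrA ler_pM2r// -ler_pdivlMl ?invrK// invr_gt0.
by rewrite mulr_gt0.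
Qed.

(** The sublevel set of the objective at the level of [y] is closed and bounded, hence compact, so a
    minimiser exists and [xget] returns one. *)
Lemma prox_argmin (R : realType) m (b : R) (g : 'rV[R]_m -> R) (L : R) y :
  0 < b -> 0 <= L -> (forall u v, `|g u - g v| <= L * enorm (u - v)) ->
  argmin setT (prox_objective b g y) (prox b g y).
Proof.
move=> b0 L0 gL; set F := prox_objective b g y.
suff : exists p, argmin setT F p by move=> /(xgetPex 0).
pose A := [set u | F u <= F y].
have cF := @prox_objective_continuous _ _ b g L y L0 gL.
have clA : closed A.
  apply: (@preimage_closed _ _ F [set r | r <= F y]); last exact: closed_le.
  by move=> u _; exact: cF.
have bA : bounded_set A.
  exists (2 * b * L + enorm y); split; first exact: num_real.
  move=> M hM u /= Au; apply: le_trans (norm_le_enorm u) (ltW _).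
  apply: le_lt_trans hM; rewrite -[u in X in X <= _](subrK y).
  rewrite (le_trans (enormD _ _))// lerD2r (@sublevel_dist _ _ b g)//.
  by rewrite -(prox_objective_at b g y).
have [] := @EVT_min_rV R m F A _ (bounded_closed_compact bA clA).
- by exists y; rewrite /A /= lexx.
- by apply: continuous_subspaceT => u; exact: cF.
- move=> p; rewrite inE => Ap hp; exists p; split=> // u _.
  have [Fu|/ltW Fu] := leP (F u) (F y); first by apply: hp; rewrite inE.
  exact: le_trans Fu.
Qed.

Lemma moreauE (R : realType) m (b : R) (g : 'rV[R]_m -> R) (L : R) y :
  0 < b -> 0 <= L -> (forall u v, `|g u - g v| <= L * enorm (u - v)) ->
  moreau b g y = prox_objective b g y (prox b g y).
Proof.
move=> b0 L0 gL; have [_ pmin] := prox_argmin y b0 L0 gL.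
apply/eqP; rewrite eq_le; apply/andP; split.
  apply: ge_inf; last by exists (prox b g y).
  by exists (prox_objective b g y (prox b g y)) => _ [u _ <-]; exact: pmin.
apply: lb_le_inf; first by exists (prox_objective b g y y), y.
by move=> _ [u _ <-]; exact: pmin.
Qed.

Lemma moreau_le (R : realType) m (b : R) (g : 'rV[R]_m -> R) (L : R) y u :
  0 < b -> 0 <= L -> (forall u v, `|g u - g v| <= L * enorm (u - v)) ->
  moreau b g y <= prox_objective b g y u.
Proof.
move=> b0 L0 gL; rewrite (moreauE y b0 L0 gL).
by have [_] := prox_argmin y b0 L0 gL; apply.
Qed.

Lemma prox_dist (R : realType) m (b : R) (g : 'rV[R]_m -> R) (L : R) y :
  0 < b -> 0 <= L -> (forall u v, `|g u - g v| <= L * enorm (u - v)) ->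
  enorm (prox b g y - y) <= 2 * b * L.
Proof.
move=> b0 L0 gL; apply: (sublevel_dist b0 L0 gL).
rewrite -(moreauE y b0 L0 gL) -(prox_objective_at b g y).
exact: (moreau_le _ _ b0 L0 gL).
Qed.

(* Test the infimum at y + d with the proximal point of y. *)
Lemma moreau_upper (R : realType) m (b : R) (g : 'rV[R]_m -> R) (L : R) y d :
  0 < b -> 0 <= L -> (forall u v, `|g u - g v| <= L * enorm (u - v)) ->
  moreau b g (y + d) <= moreau b g y + dot (b^-1 *: (y - prox b g y)) d
    + (2 * b)^-1 * enorm d ^+ 2.
Proof.
move=> b0 L0 gL; set p := prox b g y.
apply: le_trans (moreau_le _ p b0 L0 gL) _.
rewrite (moreauE y b0 L0 gL) -/p /prox_objective !enorm_sqr !dotE.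
rewrite !(dotC _ p) !(dotC d y) invfM; lra.
Qed.

(** Quadratic growth around the minimiser, obtained by testing the objective at the midpoint of [u]
    and the proximal point. The midpoint yields the factor 1/4 instead of the sharp 1/2. *)
Lemma prox_strong (R : realType) m (b rho : R) (g : 'rV[R]_m -> R) (L : R) y u :
  0 < b -> 0 <= L -> (forall u v, `|g u - g v| <= L * enorm (u - v)) ->
  weakly_convex rho g ->
  moreau b g y + (b^-1 - rho) / 4 * enorm (u - prox b g y) ^+ 2
    <= prox_objective b g y u.
Proof.
move=> b0 L0 gL; set p := prox b g y => wc.
have h0 : (0 : R) <= 1 / 2 by lra.
have h1 : (1 / 2 : R) <= 1 by lra.
have := wc (Itv01 h0 h1) u p; rewrite !inE => /(_ Logic.I Logic.I).
rewrite convRE /conv /=.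
have := moreau_le y ((1 / 2) *: u + (1 - 1 / 2) *: p) b0 L0 gL.
rewrite (moreauE y b0 L0 gL) -/p /prox_objective !enorm_sqr !dotE /unstable.onem.
rewrite (dotC p u) (dotC y u) (dotC y p) invfM => H1 H2.
lra.
Qed.

(** Quadratic growth at [y] and at [y + d], each tested with the other proximal point, is added.
    Only the cross term [b^-1 * dot (q - p) d] survives, and Cauchy-Schwarz bounds it. *)
Lemma prox_lipschitz (R : realType) m (b rho : R) (g : 'rV[R]_m -> R)
    (L : R) y d :
  0 < b -> rho * b < 1 ->
  0 <= L -> (forall u v, `|g u - g v| <= L * enorm (u - v)) ->
  weakly_convex rho g ->
  enorm (prox b g (y + d) - prox b g y) <= 2 / (1 - rho * b) * enorm d.
Proof.
move=> b0 rb L0 gL wc; set q := prox b g (y + d); set p := prox b g y.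
have := prox_strong y q b0 L0 gL wc.
have := prox_strong (y + d) p b0 L0 gL wc.
rewrite (moreauE y b0 L0 gL) (moreauE (y + d) b0 L0 gL) -/p -/q.
move: p q => p q; rewrite (enormB p q) /prox_objective => H1 H2.
have r1 : 0 < 1 - rho * b by rewrite subr_gt0.
have H : (b^-1 - rho) / 2 * enorm (q - p) ^+ 2 <= b^-1 * dot (q - p) d.
  move: H1 H2; rewrite !enorm_sqr !dotE invfM.
  rewrite (dotC p q) !(dotC y) !(dotC d).
  lra.
have {}H : (1 - rho * b) * enorm (q - p) ^+ 2 <= 2 * (enorm (q - p) * enorm d).
  have := ler_wpM2l (ltW b0) H; have := dot_le_enorm (q - p) d.
  rewrite !mulrA mulrBr mulfV ?gt_eqF// mul1r (mulrC b rho); lra.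
have [->|e0] := eqVneq (enorm (q - p)) 0.
  by rewrite mulr_ge0 ?enorm_ge0// divr_ge0// ltW.
have ep : 0 < enorm (q - p) by rewrite lt_neqAle eq_sym e0 enorm_ge0.
rewrite mulrAC ler_pdivlMr// mulrC -(ler_pM2r ep); lra.
Qed.

(** The upper side is [moreau_upper] at [y]. The lower side is [moreau_upper] from [y + d] back to
    [y], whose slope at [y + d] is moved to [y] by the Lipschitz bound on the prox. *)
Lemma moreau_quadratic (R : realType) m (b rho : R) (g : 'rV[R]_m -> R)
    (L : R) y d :
  0 < b -> rho * b < 1 ->
  0 <= L -> (forall u v, `|g u - g v| <= L * enorm (u - v)) ->
  weakly_convex rho g ->
  `|moreau b g (y + d) - moreau b g y - dot (b^-1 *: (y - prox b g y)) d|
    <= (2 / (1 - rho * b) + 1) / b * enorm d ^+ 2.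
Proof.
move=> b0 rb L0 gL wc.
have := moreau_upper (y + d) (- d) b0 L0 gL; rewrite addrK.
have := moreau_upper y d b0 L0 gL.
have := prox_lipschitz y d b0 rb L0 gL wc.
set q := prox b g (y + d); set p := prox b g y.
move: p q => p q Hqp H1 H2.
have r1 : 0 < 1 - rho * b by rewrite subr_gt0.
set c := 2 / _ in Hqp *; have c0 : 0 <= c by rewrite divr_ge0// ltW.
have Hd : dot (q - p) d <= c * enorm d ^+ 2.
  rewrite (le_trans (dot_le_enorm _ _))// expr2 mulrA.
  by rewrite ler_wpM2r ?enorm_ge0.
have B0 : 0 <= b^-1 by rewrite invr_ge0 ltW.
have HB := ler_wpM2l B0 Hd.
have d0 := mulr_ge0 B0 (sqr_ge0 (enorm d)).
have cd0 := mulr_ge0 c0 d0.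
move: H1 H2 HB; rewrite enormN !dotE -enorm_sqr invfM => H1 H2 HB.
rewrite ler_norml; apply/andP; split; lra.
Qed.

(** Along [t *: v] the error is of order [t ^+ 2], so the difference quotient is off by O(t). *)
Lemma quadratic_is_derive (R : realType) n (h : 'rV[R]_n -> R) y xi c v :
  (forall d, `|h (y + d) - h y - dot xi d| <= c * enorm d ^+ 2) ->
  is_derive y v (h : 'rV[R]_n -> R^o) (dot xi v).
Proof.
(* [w] is positive and dominates [c * enorm v ^+ 2], so [|t| <= e / w] suffices below. The sign of
   [c] is not given, but [hq] at [v] rules out a negative product. *)
move=> hq; set w := (c + 1) * enorm v ^+ 2 + 1.
have w0 : 0 < w.
  have [c0|c0] := leP 0 (c * enorm v ^+ 2).
    by rewrite /w mulrDl mul1r ltr_wpDl// addr_ge0// sqr_ge0.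
  by have := hq v; have := normr_ge0 (h (y + v) - h y - dot xi v); lra.
suff H :
    (fun t : R => t^-1 *: (((h : 'rV[R]_n -> R^o) \o shift y) (t *: v) - h y))
    @ 0^' --> (dot xi v : R^o).
  by split; [apply/cvg_ex; exists (dot xi v)|exact: cvg_lim].
apply/cvgrPdist_le => e e0; near=> t.
have t0 : t != 0 by near: t; exact: nbhs_dnbhs_neq.
have -> : (dot xi v : R^o)
    - t^-1 *: (((h : 'rV[R]_n -> R^o) \o shift y) (t *: v) - h y)
   = - (t^-1 * (h (y + t *: v) - h y - dot xi (t *: v))).
  rewrite /= (addrC _ y) /GRing.scale /= dotZr.
  by field.
rewrite normrN normrM normfV ler_pdivrMl ?normr_gt0//.
apply: le_trans (hq _) _; rewrite enormZ exprMn.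
have : `|t| * w <= e.
  rewrite -ler_pdivlMr//; near: t; apply: nbhs_dnbhs.
  have := @cvgr0_norm_le _ _ _ (nbhs (0 : R)) _ id (@cvg_id _ (nbhs (0 : R))).
  by apply; exact: divr_gt0.
rewrite /w => Ht; have := ler_wpM2l (normr_ge0 t) Ht.
have := sqr_ge0 `|t|.
have := mulr_ge0 (sqr_ge0 `|t|) (sqr_ge0 (enorm v)).
lra.
Unshelve. all: by end_near. Qed.

Lemma grad_quadratic (R : realType) n (h : 'rV[R]_n -> R) y xi c :
  (forall d, `|h (y + d) - h y - dot xi d| <= c * enorm d ^+ 2) ->
  grad h y = xi.
Proof.
move=> hq; apply/rowP => i; rewrite mxE.
have [_ ->] := quadratic_is_derive (delta_mx 0 i) hq.
rewrite /dot (bigD1 i)//= mxE !eqxx mulr1 big1 ?addr0// => j ji.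
by rewrite mxE eqxx (negbTE ji) mulr0.
Qed.

Lemma grad_moreau (R : realType) m (b rho : R) (g : 'rV[R]_m -> R) (L : R) y :
  0 < b -> rho * b < 1 ->
  0 <= L -> (forall u v, `|g u - g v| <= L * enorm (u - v)) ->
  weakly_convex rho g ->
  grad (moreau b g) y = b^-1 *: (y - prox b g y).
Proof.
move=> b0 rb L0 gL wc.
apply: grad_quadratic => d; exact: (moreau_quadratic y d b0 rb L0 gL wc).
Qed.

(** The upper bound tests the infimum at [y]. For the lower one the penalty is dropped, and [g]
    falls by at most [L] times the displacement [2 * b * L]. *)
Lemma moreau_bounds (R : realType) m (b : R) (g : 'rV[R]_m -> R) (L : R) y :
  0 < b -> 0 <= L -> (forall u v, `|g u - g v| <= L * enorm (u - v)) ->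
  g y - 2 * b * L ^+ 2 <= moreau b g y <= g y.
Proof.
move=> b0 L0 gL; apply/andP; split; last first.
  by rewrite -[leRHS](prox_objective_at b g y) (moreau_le _ _ b0 L0 gL).
rewrite (moreauE y b0 L0 gL) /prox_objective; set p := prox b g y.
have := gL y p; rewrite ler_norml => /andP[_]; rewrite enormB.
have : 0 <= (2 * b)^-1 * enorm (p - y) ^+ 2.
  by rewrite mulr_ge0 ?sqr_ge0// invr_ge0 mulr_ge0// ltW.
have := ler_wpM2l L0 (prox_dist y b0 L0 gL); rewrite -/p; lra.
Qed.

(** The proximal point for [b] is tested in the infimum for [b']. The penalty grows by
    [(b - b') / (2 * b * b')] times a squared distance of at most [(2 * b * L) ^+ 2], and
    [b / b' <= 2]. *)
Lemma moreau_mono (R : realType) m (b b' : R) (g : 'rV[R]_m -> R) (L : R) y :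
  0 < b' -> b' <= b -> b <= 2 * b' ->
  0 <= L -> (forall u v, `|g u - g v| <= L * enorm (u - v)) ->
  moreau b' g y <= moreau b g y + 4 * L ^+ 2 * (b - b').
Proof.
move=> b'0 b'b bb' L0 gL; have b0 := lt_le_trans b'0 b'b.
apply: le_trans (moreau_le y (prox b g y) b'0 L0 gL) _.
rewrite (moreauE y b0 L0 gL) /prox_objective; set p := prox b g y.
rewrite -addrA lerD2l -lerBlDl -mulrBl.
have -> : (2 * b')^-1 - (2 * b)^-1 = (b - b') / (2 * b * b').
  by field; rewrite !gt_eqF.
have b20 : 0 <= (b - b') / (2 * b * b').
  by rewrite divr_ge0 ?subr_ge0// !mulr_ge0// ltW.
have Hp : enorm (p - y) ^+ 2 <= (2 * b * L) ^+ 2.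
  rewrite ler_sqr ?nnegrE ?enorm_ge0 ?(prox_dist y b0 L0 gL)//.
  by rewrite !mulr_ge0// ltW.
apply: le_trans (ler_wpM2l b20 Hp) _.
have -> : (b - b') / (2 * b * b') * (2 * b * L) ^+ 2
   = (2 * (b - b') * L ^+ 2) * (b / b') by field; rewrite !gt_eqF.
have -> : 4 * L ^+ 2 * (b - b') = (2 * (b - b') * L ^+ 2) * 2 by ring.
by rewrite ler_wpM2l ?ler_pdivrMr// !mulr_ge0 ?sqr_ge0// subr_ge0.
Qed.

(** Minimality of [p] against [p + t *: v] bounds the difference quotient of [g] based at [p] below
    by [dot xi v] minus O(t). The base point [p] lies in every neighbourhood of itself, so the
    Clarke limsup inherits the bound. *)
Lemma prox_clarke (R : realType) m (b : R) (g : 'rV[R]_m -> R) (L : R) y :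
  0 < b -> 0 <= L -> (forall u v, `|g u - g v| <= L * enorm (u - v)) ->
  clarke_subdifferential g (prox b g y) (b^-1 *: (y - prox b g y)).
Proof.
move=> b0 L0 gL v; set p := prox b g y; set xi := _ *: _.
(* The limsup is an infimum of suprema over sets of the filter, so each such set must contain a pair
   with quotient at least [dot xi v - e]. *)
apply: le_ereal_inf_tmp => _ [V [[A B] /= [Ap B0]] ABV <-].
apply/lee_addgt0Pr => e e0.
set w := (2 * b)^-1 * enorm v ^+ 2 + 1.
have w0 : 0 < w.
  by rewrite ltr_wpDl// mulr_ge0 ?sqr_ge0// invr_ge0 mulr_ge0// ltW.
have : \forall t \near (0 : R)^'+, B t /\ 0 < t /\ t * w <= e.
  near=> t; split; [|split].
  - by near: t.
  - by near: t; exact: nbhs_right_gt.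
  - rewrite -ler_pdivlMr//; near: t; apply: nbhs_right_le; exact: divr_gt0.
move=> /filter_ex[t [Bt [t0 tw]]].
have key : dot xi v <= (g (p + t *: v) - g p) / t + e.
  rewrite -lerBlDr ler_pdivlMr//.
  have := moreau_le y (p + t *: v) b0 L0 gL.
  rewrite (moreauE y b0 L0 gL) -/p /prox_objective !enorm_sqr !dotE.
  have := ler_wpM2l (ltW t0) tw.
  rewrite /w /xi ?enorm_sqr ?dotE invfM.
  rewrite ?(dotC v) ?(dotC y) => H1 H2.
  have := mulr_gt0 t0 t0; lra.
rewrite (@le_trans _ _ ((g (p + t *: v) - g p) / t + e)%:E)//.
rewrite EFinD leeD2r//; apply: ereal_sup_ubound.
exists (p, t) => //; apply: ABV; split=> //=; exact: nbhs_singleton Ap.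
Unshelve. all: by end_near. Qed.

(** * Gaps and the descent inequality *)

(** The product form treats alike [rho = 0], where the range has no upper end, and [rho > 0]. *)
Lemma smoothing_range_lt1 (R : realType) (rho b : R) :
  0 <= rho -> smoothing_range rho b -> 0 < b /\ rho * b < 1.
Proof.
move=> rho0 [b0 H]; split=> //; move: rho0; rewrite le_eqVlt => /predU1P[<-|rho0].
  by rewrite mul0r.
by move: H; rewrite inver gt_eqF// lte_fin -[rho^-1]mulr1 ltr_pdivlMl.
Qed.

Lemma convex_segment (R : realType) n (C : set 'rV[R]_n) x y (t : R) :
  @convex_set R 'rV[R]_n C -> C x -> C y -> 0 <= t <= 1 ->
  C (x + t *: (y - x)).
Proof.
move=> convC Cx Cy /andP[t0 t1].
have := convC y x (Itv01 t0 t1); rewrite !inE => /(_ Cy Cx).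
rewrite /conv /= /unstable.onem scalerBl scale1r scalerBr.
by rewrite addrCA.
Qed.

Lemma derive_grad (R : realType) n (f : 'rV[R]_n -> R) w d :
  differentiable (f : 'rV[R]_n -> R^o) w ->
  'D_d (f : 'rV[R]_n -> R^o) w = dot (grad f w) d.
Proof.
move=> df; rewrite deriveE// {1}(row_sum_delta d) linear_sum /dot.
by apply: eq_bigr => i _; rewrite linearZ mxE deriveE// mulrC.
Qed.

(** The one-variable mean value theorem for [t |-> f (x + t *: (y - x))]; differentiability is asked
    only along the segment, which convexity keeps inside [C] in the uses below. *)
Lemma mvt_grad (R : realType) n (f : 'rV[R]_n -> R) x y :
  (forall t : R, 0 <= t <= 1 ->
    differentiable (f : 'rV[R]_n -> R^o) (x + t *: (y - x))) ->
  exists2 t : R, 0 <= t <= 1 &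
    f y - f x = dot (grad f (x + t *: (y - x))) (y - x).
Proof.
move=> df; set d := y - x.
pose phi (t : R) : R := f (x + t *: d).
have dphi (t : R) : 0 <= t <= 1 ->
    is_derive (t : R^o) (1 : R^o) (phi : R -> R^o) (dot (grad f (x + t *: d)) d).
  move=> t01.
  have E : (fun h : R => h^-1 *: (((phi : R -> R^o) \o shift t) (h *: 1) - phi t))
      = (fun h : R => h^-1 *:
          (((f : 'rV[R]_n -> R^o) \o shift (x + t *: d)) (h *: d)
            - f (x + t *: d))).
    apply/funext => h; rewrite /phi /=; congr (_ *: (f _ - _)).
    by rewrite [h%:A](mulr1 h) scalerDl addrCA.
  split; first by rewrite /derivable E; exact: diff_derivable (df _ t01).
  by rewrite /derive E -derive_grad//; exact: df.
have [||t t01] :=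
  @MVT_segment R phi (fun t => dot (grad f (x + t *: d)) d) 0 1 ler01.
- by move=> t /[!in_itv]/= /andP[t0 t1]; apply: dphi; rewrite !ltW.
- apply: derivable_within_continuous => t /[!in_itv]/= t01.
  by have [] := dphi t t01.
rewrite /phi scale0r addr0 scale1r /d subrKC subr0 mulr1 => ->.
by exists t => //; move: t01; rewrite in_itv.
Qed.

(** The quadratic expansion of the envelope pulls back through [T] at the cost of a factor [K ^+ 2],
    which identifies its gradient. This links the linear minimisation in FRAMES to the vector in the
    gaps. *)
Lemma grad_composite (R : realType) n m (T : {linear 'rV[R]_n -> 'rV[R]_m})
    (f : 'rV[R]_n -> R) (b rho : R) (g : 'rV[R]_m -> R) (L : R) x :
  0 < b -> rho * b < 1 ->
  0 <= L -> (forall u v, `|g u - g v| <= L * enorm (u - v)) ->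
  weakly_convex rho g ->
  differentiable (f : 'rV[R]_n -> R^o) x ->
  grad (fun y => f y + moreau b g (T y)) x =
    grad f x + adjoint T (grad (moreau b g) (T x)).
Proof.
move=> b0 rb L0 gL wc df; have [K K0 TK] := linear_enorm_bounded T.
set xi := grad _ (T x).
have xiE : xi = b^-1 *: (T x - prox b g (T x)) := grad_moreau _ b0 rb L0 gL wc.
set c := (2 / (1 - rho * b) + 1) / b.
have c0 : 0 <= c.
  by rewrite divr_ge0 ?ltW// addr_gt0// divr_gt0// subr_gt0.
have hq d : `|(moreau b g \o T) (x + d) - (moreau b g \o T) x
    - dot (adjoint T xi) d| <= (c * K ^+ 2) * enorm d ^+ 2.
  rewrite /= linearD dotC -adjointP dotC xiE.
  apply: le_trans (moreau_quadratic (T x) (T d) b0 rb L0 gL wc) _.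
  rewrite -/c -[leRHS]mulrA ler_wpM2l// -exprMn ler_sqr ?nnegrE ?enorm_ge0//.
  by rewrite mulr_ge0 ?enorm_ge0.
rewrite -(grad_quadratic hq); apply/rowP => i; rewrite !mxE.
have [dm _] := quadratic_is_derive (delta_mx 0 i) hq.
have dfi : derivable (f : 'rV[R]_n -> R^o) x 'e_i by exact: diff_derivable.
exact: (deriveD dfi dm).
Qed.

Lemma subgradient_gap_le (R : realType) n m (C : set 'rV[R]_n)
    (f : 'rV[R]_n -> R) (T : {linear 'rV[R]_n -> 'rV[R]_m}) x xi (B : R) :
  C !=set0 ->
  (forall s, C s -> dot (grad f x + adjoint T xi) (x - s) <= B) ->
  subgradient_gap C f T x xi <= B.
Proof.
move=> [c Cc] hB; apply: ge_sup.
  by exists (dot (grad f x + adjoint T xi) (x - c)), c.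
by move=> _ [s Cs <-]; exact: hB.
Qed.

(** Compactness bounds the set of values, so that its [sup] is a genuine upper bound. *)
Lemma le_subgradient_gap (R : realType) n m (C : set 'rV[R]_n)
    (f : 'rV[R]_n -> R) (T : {linear 'rV[R]_n -> 'rV[R]_m}) x xi s :
  compact C -> C x -> C s ->
  dot (grad f x + adjoint T xi) (x - s) <= subgradient_gap C f T x xi.
Proof.
move=> /compact_enorm_diameter[D D0 hD] Cx Cs; apply: ub_le_sup; last by exists s.
exists (enorm (grad f x + adjoint T xi) * D) => _ [u Cu <-].
by rewrite (le_trans (dot_le_enorm _ _))// ler_wpM2l ?enorm_ge0 ?hD.
Qed.

Lemma subgradient_gap_ge0 (R : realType) n m (C : set 'rV[R]_n)
    (f : 'rV[R]_n -> R) (T : {linear 'rV[R]_n -> 'rV[R]_m}) x xi :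
  compact C -> C x -> 0 <= subgradient_gap C f T x xi.
Proof.
move=> cC Cx; apply: le_trans (le_subgradient_gap f T xi cC Cx Cx).
by rewrite subrr dotC -(scale0r (0 : 'rV[R]_n)) dotZl mul0r.
Qed.

(* The envelope part of the extra term, - |T z - T x|^2 / b, is nonpositive, so
   only the gradient of f contributes to the error. *)
Lemma lifted_gap_le (R : realType) n m (C : set 'rV[R]_n)
    (f : 'rV[R]_n -> R) (T : {linear 'rV[R]_n -> 'rV[R]_m})
    (g : 'rV[R]_m -> R) (b L Lf D G M : R) x z :
  compact C -> C x ->
  0 < b -> 0 <= L -> (forall u v, `|g u - g v| <= L * enorm (u - v)) ->
  0 <= Lf -> (forall u v, C u -> C v ->
    enorm (grad f u - grad f v) <= Lf * enorm (u - v)) ->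
  (forall u v, C u -> C v -> enorm (u - v) <= D) ->
  (forall u, C u -> enorm (grad f u) <= G) ->
  0 <= M -> prox_lift C T g M x b z ->
  subgradient_gap C f T z (b^-1 *: (T x - prox b g (T x))) <=
  subgradient_gap C f T x (b^-1 *: (T x - prox b g (T x)))
    + (Lf * D + G) * M * (2 * L) * b.
Proof.
move=> cC Cx b0 L0 gL Lf0 fL CD CG M0 [Cz Tz zx]; set xi := _ *: _.
have zxb : enorm (z - x) <= M * (2 * b * L).
  by rewrite (le_trans zx)// ler_wpM2l// Tz (prox_dist _ b0 L0 gL).
apply: subgradient_gap_le => [|s Cs]; first by exists x.
have H1 := le_subgradient_gap f T xi cC Cx Cs.
(* The left sides of [H2], [H3] and [H4] sum to the change of the pairing with a fixed [s] when [x]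
   is replaced by [z]. *)
have H2 : dot (grad f z - grad f x) (z - s) <= Lf * enorm (z - x) * D.
  rewrite (le_trans (dot_le_enorm _ _))// ler_pM ?enorm_ge0//.
  - exact: fL.
  - exact: CD.
have H3 : dot (grad f x) (z - x) <= G * enorm (z - x).
  by rewrite (le_trans (dot_le_enorm _ _))// ler_wpM2r ?enorm_ge0 ?CG.
have H4 : dot (adjoint T xi) (z - x) <= 0.
  rewrite dotC -adjointP dotC linearB /= Tz -opprB dotNr /xi dotZl oppr_le0.
  by rewrite mulr_ge0 ?dot_ge0// invr_ge0 ltW.
have D0 : 0 <= D by apply: le_trans (CD _ _ Cx Cx); exact: enorm_ge0.
have G0 : 0 <= G by apply: le_trans (CG _ Cx); exact: enorm_ge0.
have LG0 : 0 <= Lf * D + G by rewrite addr_ge0// mulr_ge0.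
have := ler_wpM2l LG0 zxb.
move: H1 H2 H3 H4; rewrite !dotE; lra.
Qed.

(** The mean value theorem with the Lipschitz gradient handles [f], and [moreau_upper] with
    increment [T (x' - x)] handles the envelope. The quadratic terms lose their factors 1/2, which
    does not affect the rate. *)
Lemma frank_wolfe_descent (R : realType) n m (C : set 'rV[R]_n)
    (f : 'rV[R]_n -> R) (T : {linear 'rV[R]_n -> 'rV[R]_m})
    (g : 'rV[R]_m -> R) (b L Lf D K t : R) x s :
  @convex_set R 'rV[R]_n C -> C x -> C s -> 0 <= t <= 1 ->
  0 < b -> 0 <= L -> (forall u v, `|g u - g v| <= L * enorm (u - v)) ->
  (forall u, C u -> differentiable (f : 'rV[R]_n -> R^o) u) ->
  0 <= Lf -> (forall u v, C u -> C v ->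
    enorm (grad f u - grad f v) <= Lf * enorm (u - v)) ->
  (forall u v, C u -> C v -> enorm (u - v) <= D) ->
  0 <= K -> (forall u, enorm (T u) <= K * enorm u) ->
  f (x + t *: (s - x)) + moreau b g (T (x + t *: (s - x)))
    <= f x + moreau b g (T x)
     - t * dot (grad f x + adjoint T (b^-1 *: (T x - prox b g (T x)))) (x - s)
     + t ^+ 2 * (Lf * D ^+ 2 + K ^+ 2 * D ^+ 2 / b).
Proof.
move=> convC Cx Cs t01 b0 L0 gL df Lf0 fL CD K0 TK.
have /andP[t0 t1] := t01.
set xi := b^-1 *: _; set x' := x + _.
have Cx' : C x' by exact: convex_segment.
have D0 : 0 <= D by apply: le_trans (CD _ _ Cx Cx); exact: enorm_ge0.
have [|r r01 fx'] := @mvt_grad _ _ f x x'.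
  by move=> r r01; apply: df; exact: convex_segment.
have /andP[r0 r1] := r01.
set w := x + _ in fx'.
have Cw : C w by exact: convex_segment.
have sx : enorm (s - x) <= D by exact: CD.
have x'x : x' - x = t *: (s - x) by rewrite /x' addrC addKr.
have Hd : enorm (x' - x) <= t * D by rewrite x'x enormZ ger0_norm// ler_wpM2l.
have Hw : enorm (w - x) <= t * D.
  rewrite /w addrC addKr enormZ ger0_norm// (le_trans _ Hd)//.
  by rewrite ler_piMl ?enorm_ge0.
have H1 : dot (grad f w - grad f x) (x' - x) <= Lf * (t * D) * (t * D).
  rewrite (le_trans (dot_le_enorm _ _))// ler_pM ?enorm_ge0//.
  by rewrite (le_trans (fL _ _ Cw Cx))// ler_wpM2l.
have H2 := moreau_upper (T x) (T (x' - x)) b0 L0 gL.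
have TxE : T x + T (x' - x) = T x' by rewrite -linearD addrC subrK.
rewrite TxE -/xi (dotC xi) adjointP dotC in H2.
have H3 : (2 * b)^-1 * enorm (T (x' - x)) ^+ 2 <= b^-1 * (K ^+ 2 * (t * D) ^+ 2).
  rewrite ler_pM ?invr_ge0 ?sqr_ge0 ?mulr_ge0 ?(ltW b0)//.
    by rewrite lef_pV2 ?posrE ?mulr_gt0// ler_peMl ?(ltW b0)// ler1n.
  rewrite -exprMn ler_sqr ?nnegrE ?enorm_ge0 ?mulr_ge0//.
  by rewrite (le_trans (TK _))// ler_wpM2l.
have -> : t * dot (grad f x + adjoint T xi) (x - s)
    = - (dot (grad f x) (x' - x) + dot (adjoint T xi) (x' - x)).
  by rewrite -dotDl x'x dotZr -(opprB s x) dotNr mulrN.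
move: fx' H1 H2 H3; rewrite dotDl dotNl.
lra.
Qed.

(** * Summation *)

Lemma leq_upper_half n : (n <= 2 * (n - n %/ 2))%N.
Proof. lia. Qed.

(** Fourth roots enter only through [q k ^+ 4 = k%:R], which turns the rate estimates into
    polynomial inequalities. *)
Section Root4Rate.
Variables (R : realType) (q : nat -> R).
Hypothesis q0 : forall k, 0 <= q k.
Hypothesis q4 : forall k, q k ^+ 4 = k%:R.

Lemma root4_mono i j : (i <= j)%N -> q i <= q j.
Proof. by move=> ij; rewrite -(@ler_pXn2r _ 4)// ?nnegrE// !q4 ler_nat. Qed.

Lemma root4_double i j : (i <= 2 * j)%N -> q i <= 2 * q j.
Proof.
move=> ij; rewrite -(@ler_pXn2r _ 4)// ?nnegrE ?mulr_ge0//.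
rewrite exprMn !q4 -natrX -natrM ler_nat (leq_trans ij)//.
by rewrite leq_mul2r orbT.
Qed.

Lemma root4_ge1 k : 1 <= q k.+1.
Proof. by rewrite -(@ler_pXn2r _ 4)// ?nnegrE// q4 expr1n ler1n. Qed.

(** A telescoping substitute for comparing the sum of [k ^ (-1/4)] with an integral; it yields the
    order 3/4. *)
Lemma root4_step k : (q k.+1)^-1 <= 2 * (q k.+1 ^+ 3 - q k ^+ 3).
Proof.
have b1 := root4_ge1 k; have ab := root4_mono (leqnSn k); have a0 := q0 k.
have := q4 k.+1; rewrite -natr1 -q4; move: b1 ab a0.
set b := q k.+1; set a := q k => b1 ab a0 E.
have b0 : 0 < b by exact: lt_le_trans b1.
rewrite -[_^-1]mul1r ler_pdivrMr//.
(* The product equals [b ^+ 4 - 2 * a ^+ 3 * b + a ^+ 4], the gap between the two sides once 1 is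
   written as [b ^+ 4 - a ^+ 4]. *)
have H : 0 <= (b - a) * (b * (b ^+ 2 + a * b) + a ^+ 2 * (b - a)).
  have ba : 0 <= b - a by rewrite subr_ge0.
  have bge0 := ltW b0.
  rewrite mulr_ge0// addr_ge0 ?mulr_ge0 ?sqr_ge0//.
  by rewrite addr_ge0 ?mulr_ge0 ?sqr_ge0.
lra.
Qed.

(* q (k + 1) ^ 2 is the inverse of the k-th step size; E is the shifted Psi. *)
Lemma average_rate (G E : nat -> R) (H c : R) : 0 <= c ->
  (forall k, 0 <= E k <= H) ->
  (forall k, G k <= q k.+1 ^+ 2 * (E k - E k.+1) + c / q k.+1) ->
  forall N, \sum_(0 <= k < N.+1) G k <= (H + 2 * c) * q N.+1 ^+ 3.
Proof.
move=> c0 E0 GE N.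
(* Summation by parts as an induction: the boundary term [q M ^+ 2 * (H - E M)] is carried along,
   and each step discards [(q M.+1 ^+ 2 - q M ^+ 2) * (H - E M) >= 0]. *)
have key M : \sum_(0 <= k < M) G k <= q M ^+ 2 * (H - E M) + 2 * c * q M ^+ 3.
  elim: M => [|M IH].
    rewrite big_nil addr_ge0// mulr_ge0 ?exprn_ge0 ?mulr_ge0//.
    by rewrite subr_ge0; have /andP[] := E0 0%N.
  rewrite big_nat_recr//=.
  have := ler_wpM2l c0 (root4_step M).
  have : 0 <= (q M.+1 ^+ 2 - q M ^+ 2) * (H - E M).
    rewrite mulr_ge0 ?subr_ge0//; last by have /andP[] := E0 M.
    by rewrite ler_sqr ?nnegrE// root4_mono.
  have := GE M; lra.
apply: le_trans (key _) _; have q1 := root4_ge1 N.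
have /andP[E1 E2] := E0 N.+1.
have H1 : q N.+1 ^+ 2 * (H - E N.+1) <= q N.+1 ^+ 3 * H.
  rewrite ler_pM ?exprn_ge0 ?subr_ge0//; last by rewrite lerBlDr lerDl.
  by rewrite ler_weXn2l.
lra.
Qed.

End Root4Rate.

(** * Convergence rates for FRAMES *)

Theorem theorem6p12 (R : realType) (n m : nat)
    (C : set 'rV[R]_n) (C_nonempty : C !=set0) (C_compact : compact C)
    (C_convex : @convex_set R 'rV[R]_n C)
    (f : 'rV[R]_n -> R) (U : set 'rV[R]_n) (U_open : open U) (CU : C `<=` U)
    (f_diff : forall x, U x -> differentiable (f : 'rV[R]_n -> R^o) x)
    (f_C1 : forall x, U x -> {for x, continuous (grad f)})
    (Lf : R)
    (f_smooth : forall x y, C x -> C y ->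
      enorm (grad f x - grad f y) <= Lf * enorm (x - y))
    (T : {linear 'rV[R]_n -> 'rV[R]_m})
    (g : 'rV[R]_m -> R) (Lg : R)
    (g_lipschitz : forall u v, `|g u - g v| <= Lg * enorm (u - v))
    (rho : R) (rho_ge0 : 0 <= rho) (g_weakly_convex : weakly_convex rho g)
    (Mlift : R) (Mlift_gt0 : 0 < Mlift)
    (lift_property : forall x beta, C x -> smoothing_range rho beta ->
      exists z, prox_lift C T g Mlift x beta z)
    (beta0 : R) (beta0_range : smoothing_range rho beta0)
    (gamma beta : nat -> R)
    (gammaE : forall k, gamma k = k.+1%:R `^ (- 2^-1))
    (betaE : forall k, beta k = beta0 * k.+1%:R `^ (- 4^-1))
    (x s : nat -> 'rV[R]_n)
    (x_frames : frames C f T g rho gamma beta x s)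
    (z : nat -> 'rV[R]_n)
    (z_lift : forall k, prox_lift C T g Mlift (x k) (beta k) (z k))
    (xi : nat -> 'rV[R]_m)
    (xiE : forall k, xi k = grad (moreau (beta k) g) (T (x k))) :
  (* xi_k is a Clarke subgradient at T z_k, so that the gaps below make sense *)
  (forall k, clarke_subdifferential g (T (z k)) (xi k)) /\
  (exists Cns : R, 0 < Cns /\
    forall N : nat, (1 <= N)%N ->
      (0 <= N%:R^-1 * \sum_(0 <= k < N) subgradient_gap C f T (z k) (xi k)
         <= Cns * N%:R `^ (- 4^-1)) /\
      (* the default value of the iterated min is its k = 0 term *)
      (0 <= \big[Num.min/subgradient_gap C f T (z 0%N) (xi 0%N)]_(0 <= k < N)
              subgradient_gap C f T (z k) (xi k)
         <= Cns * N%:R `^ (- 4^-1))) /\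
  (exists K : R, 0 < K /\
    forall N : nat, (2 <= N)%N ->
      forall kN : nat,
        argmin [set k | (N %/ 2 <= k <= N.-1)%N]
               (fun k => smoothed_gap C f T g (beta k) (x k)) kN ->
        `|subgradient_gap C f T (z kN) (xi kN)| <= K * N%:R `^ (- 4^-1)).
Proof.
have [Cx0 _ beta_range s_min xS] := x_frames.
(* [Lg] and [Lf] carry no sign assumption; their absolute values are still Lipschitz constants. *)
pose L := `|Lg|; pose Lf' := `|Lf|.
have L0 : 0 <= L by exact: normr_ge0.
have Lf0 : 0 <= Lf' by exact: normr_ge0.
have gL u v : `|g u - g v| <= L * enorm (u - v).
  by rewrite (le_trans (g_lipschitz u v))// ler_wpM2r ?enorm_ge0 ?ler_norm.
have fL u v : C u -> C v -> enorm (grad f u - grad f v) <= Lf' * enorm (u - v).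
  move=> Cu Cv; rewrite (le_trans (f_smooth _ _ Cu Cv))//.
  by rewrite ler_wpM2r ?enorm_ge0 ?ler_norm.
have df u : C u -> differentiable (f : 'rV[R]_n -> R^o) u.
  by move=> /CU; exact: f_diff.
have [D D0 CD] := compact_enorm_diameter C_compact.
have [K K0 TK] := linear_enorm_bounded T.
have bP k : 0 < beta k /\ rho * beta k < 1.
  exact: smoothing_range_lt1 (beta_range k).
have b00 : 0 < beta0 by have [] := beta0_range.
(* In terms of [q], [gamma k] is [q k.+1 ^- 2] and [beta k] is [beta0 / q k.+1]. *)
pose q (k : nat) : R := k%:R `^ (4^-1).
have q0 k : 0 <= q k by exact: powR_ge0.
have q4 k : q k ^+ 4 = k%:R.
  by rewrite -powR_mulrn ?q0// -powRrM mulVf// powRr1.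
have q1 k : 1 <= q k.+1 by exact: root4_ge1.
have qp k : 0 < q k.+1 by exact: lt_le_trans (q1 k).
have qN k : k%:R `^ (- 4^-1) = (q k)^-1 by exact: powRN.
have gE k : gamma k = (q k.+1 ^+ 2)^-1.
  rewrite gammaE powRN /q -powR_mulrn ?powR_ge0// -powRrM.
  by congr (_ `^ _)^-1; field.
have bE k : beta k = beta0 / q k.+1 by rewrite betaE qN.
have g01 k : 0 <= gamma k <= 1.
  rewrite gE invr_ge0 exprn_ge0//= invf_le1 ?exprn_gt0//.
  by rewrite exprn_ege1.
have Cs k : C (s k) by have [] := s_min k.
have Cx k : C (x k).
  by elim: k => // k IH; rewrite xS; exact: convex_segment.
have Cz k : C (z k) by have [] := z_lift k.
have Tz k : T (z k) = prox (beta k) g (T (x k)) by have [] := z_lift k.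
have xiP k : xi k = (beta k)^-1 *: (T (x k) - prox (beta k) g (T (x k))).
  have [b0 rb] := bP k.
  by rewrite xiE (grad_moreau _ b0 rb L0 gL g_weakly_convex).
pose G := enorm (grad f (x 0%N)) + Lf' * D.
have CG u : C u -> enorm (grad f u) <= G.
  move=> Cu; rewrite -(subrK (grad f (x 0%N)) (grad f u)) addrC.
  rewrite (le_trans (enormD _ _))// lerD2l (le_trans (fL _ _ Cu Cx0))//.
  by rewrite ler_wpM2l// CD.
have G0 : 0 <= G by rewrite /G addr_ge0 ?enorm_ge0// mulr_ge0.
(* Since [xi k] is the gradient of the envelope at [T (x k)], [Gx k] is the smoothed gap at
   [x k]. *)
pose Gx k := subgradient_gap C f T (x k) (xi k).
pose Gz k := subgradient_gap C f T (z k) (xi k).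
have Gx0 k : 0 <= Gx k by exact: subgradient_gap_ge0.
have Gz0 k : 0 <= Gz k by exact: subgradient_gap_ge0.
pose c1 := (Lf' * D + G) * Mlift * (2 * L) * beta0.
have c10 : 0 <= c1
  by rewrite /c1 !mulr_ge0 ?(ltW Mlift_gt0) ?(ltW b00)// addr_ge0// mulr_ge0.
have GzGx k : Gz k <= Gx k + c1 / q k.+1.
  have [b0 _] := bP k; rewrite /Gz /Gx xiP.
  apply: le_trans (lifted_gap_le C_compact (Cx k) b0 L0 gL Lf0 fL CD CG
    (ltW Mlift_gt0) (z_lift k)) _.
  by rewrite lerD2l bE mulrA.
pose Psi k := f (x k) + moreau (beta k) g (T (x k)) + 4 * L ^+ 2 * beta k.
pose A := Lf' * D ^+ 2; pose B := K ^+ 2 * D ^+ 2.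
have A0 : 0 <= A by rewrite /A mulr_ge0 ?sqr_ge0.
have B0 : 0 <= B by rewrite /B mulr_ge0 ?sqr_ge0.
have descent k :
    Psi k.+1 <= Psi k - gamma k * Gx k + gamma k ^+ 2 * (A + B / beta k).
  have [b0 rb] := bP k; have [b'0 _] := bP k.+1; have /andP[gk0 gk1] := g01 k.
  have qq : q k.+1 <= q k.+2 by exact: root4_mono.
  have bb : beta k.+1 <= beta k.
    by rewrite !bE ler_pM2l// lef_pV2 ?posrE.
  (* This reduces to [k + 2 <= 2 * (k + 1)] under the fourth root. *)
  have bb2 : beta k <= 2 * beta k.+1.
    rewrite !bE mulrCA ler_pM2l// -[2]invrK -invfM lef_pV2 ?posrE ?mulr_gt0//.
    rewrite mulrC ler_pdivrMr// mulrC.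
    apply: (root4_double q0 q4).
    by rewrite mul2n -addnn addSn ltnS addnS ltnS leq_addr.
  have := moreau_mono (T (x k.+1)) b'0 bb bb2 L0 gL.
  have := frank_wolfe_descent C_convex (Cx k) (Cs k) (g01 k) b0 L0 gL df Lf0 fL
    CD K0 TK.
  rewrite -xS -xiP -/A -/B.
  (* [s k] minimises the linear form over [C], so it attains the maximum that defines the gap. *)
  have : Gx k <= dot (grad f (x k) + adjoint T (xi k)) (x k - s k).
    apply: subgradient_gap_le => // v Cv.
    have [_ /(_ _ Cv)] := s_min k.
    rewrite (grad_composite T b0 rb L0 gL g_weakly_convex (df _ (Cx k))) -xiE.
    by rewrite !(dotDr _ (x k)) !dotNr lerD2l lerN2.
  move=> /(ler_wpM2l gk0); rewrite /Psi; lra.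
pose c := A + B / beta0.
have c0 : 0 <= c by rewrite /c addr_ge0// divr_ge0// ltW.
(* Over [C], [f] varies from its value at [x 0] by at most [G * D], and [g] after [T] by at most
   [L * (K * D)]. The envelope deficit [2 * beta k * L ^+ 2] is absorbed by the correction in
   [Psi]. *)
pose m0 := f (x 0%N) - G * D + g (T (x 0%N)) - L * (K * D).
pose H := 2 * (G * D) + 2 * (L * (K * D)) + 4 * L ^+ 2 * beta0.
pose E k := Psi k - m0.
have E0 k : 0 <= E k <= H.
  have [b0 _] := bP k.
  have bk : beta k <= beta0 by rewrite bE ler_pdivrMr// ler_peMr// ltW.
  have := ler_wpM2l (mulr_ge0 (ler0n R 4) (sqr_ge0 L)) bk.
  have : 0 <= L ^+ 2 * beta k by rewrite mulr_ge0 ?sqr_ge0// ltW.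
  have /andP[] := moreau_bounds (T (x k)) b0 L0 gL.
  have : `|f (x k) - f (x 0%N)| <= G * D.
    have [|t t01 ->] := @mvt_grad _ _ f (x 0%N) (x k).
      by move=> t t01; apply: df; exact: convex_segment.
    rewrite (le_trans (cauchy_schwarz _ _))// ler_pM ?enorm_ge0 ?CD//.
    by apply: CG; exact: convex_segment.
  have : `|g (T (x k)) - g (T (x 0%N))| <= L * (K * D).
    rewrite (le_trans (gL _ _))// ler_wpM2l// -linearB (le_trans (TK _))//.
    by rewrite ler_wpM2l// CD.
  rewrite !ler_norml => /andP[g1 g2] /andP[f1 f2] m1 m2 b1 b2.
  by rewrite /E /H /m0 /Psi; apply/andP; split; lra.
(* The descent inequality is divided by [gamma k]. The error becomes
   [A / q k.+1 ^+ 2 + B / beta0 / q k.+1], and [q k.+1 >= 1] merges both terms into [c / q k.+1]. *)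
have rate k : Gx k <= q k.+1 ^+ 2 * (E k - E k.+1) + c / q k.+1.
  have q2 : 0 < q k.+1 ^+ 2 by rewrite exprn_gt0.
  have -> : E k - E k.+1 = Psi k - Psi k.+1 by rewrite /E; lra.
  have := ler_wpM2l (ltW q2) (descent k).
  have -> : q k.+1 ^+ 2 *
        (Psi k - gamma k * Gx k + gamma k ^+ 2 * (A + B / beta k))
      = q k.+1 ^+ 2 * Psi k - Gx k + (A / q k.+1 ^+ 2 + B / beta0 / q k.+1).
    by rewrite gE bE; field; rewrite !gt_eqF.
  have : A / q k.+1 ^+ 2 <= A / q k.+1.
    by rewrite ler_wpM2l// lef_pV2 ?posrE// expr2 ler_peMl.
  rewrite /c mulrDl; lra.
have ratez k : Gz k <= q k.+1 ^+ 2 * (E k - E k.+1) + (c + c1) / q k.+1.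
  by rewrite mulrDl addrA (le_trans (GzGx k))// lerD2r.
have H0 : 0 <= H by have /andP[/le_trans] := E0 0%N; apply.
have cc0 : 0 <= c + c1 by exact: addr_ge0.
pose S := H + 2 * (c + c1) + 1.
(* Stated for a free [c'] to serve both [Gx] (with [c]) and [Gz] (with [c + c1]). Dividing the order
   [q N.+1 ^+ 3] by [N.+1 = q N.+1 ^+ 4] leaves [1 / q N.+1]. *)
have avg (F : nat -> R) c' : 0 <= c' -> c' <= c + c1 ->
    (forall k, F k <= q k.+1 ^+ 2 * (E k - E k.+1) + c' / q k.+1) ->
    forall N, (N.+1)%:R^-1 * \sum_(0 <= k < N.+1) F k <= S / q N.+1.
  move=> c'0 c'c FE N.
  rewrite ler_pdivrMl ?ltr0n// -q4.
  rewrite (le_trans (average_rate q0 q4 c'0 E0 FE N))//.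
  have -> : q N.+1 ^+ 4 * (S / q N.+1) = S * q N.+1 ^+ 3.
    by field; rewrite gt_eqF.
  by rewrite ler_wpM2r ?exprn_ge0// /S; lra.
split.
  move=> k; have [b0 _] := bP k; rewrite Tz xiP.
  exact: (prox_clarke _ b0 L0 gL).
split.
  exists S; split; first by rewrite /S; lra.
  case=> // N _; rewrite qN.
  have avgN := avg _ _ cc0 (lexx _) ratez N.
  split; apply/andP; split.
  - by rewrite mulr_ge0 ?invr_ge0 ?ler0n// sumr_ge0// => k _; exact: Gz0.
  - exact: avgN.
  - elim/big_ind : _ => [|a b a0 b0|k _]; [exact: Gz0| |exact: Gz0].
    by rewrite le_min a0.
  - apply: le_trans avgN; rewrite ler_pdivlMl ?ltr0n//.
    set mn := \big[_/_]_(_ <= _ < _) _.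
    have : \sum_(0 <= k < N.+1) mn <= \sum_(0 <= k < N.+1) Gz k.
      apply: ler_sum_nat => k kN.
      by apply: ge_bigmin_seq => //; rewrite mem_index_iota.
    by rewrite sumr_const_nat subn0 mulr_natl.
(* [2 * S] bounds the smoothed gap at the selected index, and [2 * c1] the cost of passing from [x]
   to [z]. *)
exists (2 * S + 2 * c1); split; first by rewrite /S; lra.
(* From here the horizon of the statement is [N.+1], so the window ends at [N]. *)
case=> // N N2 kN [/andP[kN1 kN2] kmin]; rewrite qN ger0_norm ?Gz0//.
have N0 : (0 : R) < N.+1%:R by rewrite ltr0n.
have GkN : Gx kN <= 2 * S / q N.+1.
  have cc1 : c <= c + c1 by rewrite lerDl.
  have := avg _ _ c0 cc1 rate N; rewrite ler_pdivrMl// => avgN.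
  (* The first half of the sum is nonnegative and is dropped; each term of the window is at least
     [Gx kN]. *)
  have : (N.+1 - N.+1 %/ 2)%:R * Gx kN <= \sum_(0 <= k < N.+1) Gx k.
    rewrite (@big_cat_nat _ _ _ (N.+1 %/ 2))//=; last exact: leq_div.
    rewrite ler_wpDl ?sumr_ge0//.
    rewrite mulr_natl -sumr_const_nat; apply: ler_sum_nat => k /andP[k1 k2].
    have := kmin k; rewrite /smoothed_gap -!xiE; apply.
    by apply/andP; split.
  move=> /le_trans/(_ avgN).
  have : N.+1%:R / 2 <= (N.+1 - N.+1 %/ 2)%:R :> R.
    rewrite ler_pdivrMr// mulrC. by rewrite -natrM ler_nat leq_upper_half.
  move=> /(ler_wpM2r (Gx0 kN)) H1 /(le_trans H1).
  have -> : N.+1%:R / 2 * Gx kN = N.+1%:R * (Gx kN / 2) by rewrite mulrAC mulrA.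
  by rewrite (ler_pM2l N0) ler_pdivrMr// mulrC mulrA.
(* From [N.+1 %/ 2 <= kN] follows [N.+1 <= 2 * kN.+1], so the lift error at [kN] is of the order of
   the horizon. *)
have qk : (q kN.+1)^-1 <= 2 / q N.+1.
  rewrite -[2]invrK -invfM lef_pV2 ?posrE ?mulr_gt0//.
  rewrite mulrC ler_pdivrMr// mulrC.
  apply: (root4_double q0 q4); rewrite mulnC.
  apply: ltnW; apply: leq_trans (ltn_ceil N.+1 (isT : 0 < 2)%N) _.
  by rewrite leq_mul2r /= ltnS.
have := GzGx kN; have := ler_wpM2l c10 qk; rewrite -/(Gz kN); lra.
Qed.
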